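(* Let $\mathcal{C}\subseteq\mathbb{H}$. If $\mathcal{C}$ can be expressed as $\mathcal{C}=\mathcal{X}^\circ$ for some compact subset $\mathcal{X}\subseteq\mathbb{H}_1$, then $$V^{\mathcal{C}}_{\mathcal{S}_+}(\rho)=\tfrac12\left(\Gamma_{\mathcal{S}_+\cup(-\mathcal{X})}(\rho)-1\right)$$ for any $\rho\in\mathbb{D}$. Likewise, if $\mathcal{C}=\mathcal{Y}^\circ$ for some compact $\mathcal{Y}\subseteq-\mathbb{H}_1$, then $$V^{\mathcal{C}}_{\mathcal{S}_+}(\rho)=\Gamma_{\mathcal{S}_+\cup\left(-\frac12\mathcal{Y}\right)}(\rho)-1$$ for any $\rho\in\mathbb{D}$.
   Context: Fix $d\ge 1$. $\mathcal{V}\subseteq\mathbb{C}^d$ is a nonempty compact set of unit vectors such that $|\psi\rangle\in\mathcal{V}$ implies $e^{i\theta}|\psi\rangle\in\mathcal{V}$ for all real $\theta$. $\mathbb{H}$ is the real vector space of $d\times d$ Hermitian matrices with inner product $\langle A,B\rangle=\mathrm{Tr}(AB)$, $\mathbb{H}_1=\{X\in\mathbb{H} : \mathrm{Tr}\,X=1\}$, and $\mathbb{D}$ is the set of density matrices. Put $\mathcal{S}_+=\{|v\rangle\langle v| : |v\rangle\in\mathcal{V}\}$. For $\mathcal{A}\subseteq\mathbb{H}$: the polar set is $\mathcal{A}^\circ=\{X\in\mathbb{H} : \langle X,A\rangle\le1\ \forall A\in\mathcal{A}\}$ and the dual cone is $\mathcal{A}^*=\{X\in\mathbb{H} : \langle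 X,A\rangle\ge0\ \forall A\in\mathcal{A}\}$; for compact $\mathcal{A}$ the atomic gauge is $\Gamma_{\mathcal{A}}(X)=\inf\{\lambda\in\mathbb{R}_+ : X\in\lambda\,\mathrm{conv}(\mathcal{A})\}$, with $\inf\emptyset=\infty$. The witness-based measure associated with $\mathcal{C}$ is $$V^{\mathcal{C}}_{\mathcal{S}_+}(\rho)=\sup\{-\langle\rho,W\rangle : W\in\mathcal{S}_+^*\cap\mathcal{C}\}\in[-\infty,\infty].$$ *)

(* Defs.v *)
From HB Require Import structures.
From mathcomp Require Import all_boot all_order all_algebra.
From mathcomp Require Import sesquilinear spectral.
From mathcomp Require Import all_classical all_reals all_analysis.
From mathcomp Require Import complex.

Set Implicit Arguments.
Unset Strict Implicit.
Unset Printing Implicit Defensive.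

Import Order.TTheory GRing.Theory Num.Theory.
Import numFieldNormedType.Exports.

Local Open Scope classical_set_scope.
Local Open Scope ring_scope.
Local Open Scope complex_scope.
Local Open Scope sesquilinear_scope.

(* The library puts a topology on every abstract numFieldType, but not on the
   concrete type R[i]: transfer the usual normed structure (the norm is the
   complex modulus), so that complex matrices inherit the usual topology of
   a finite-dimensional space. *)
HB.instance Definition _ (R : rcfType) := NormedModule.copy R[i] (R[i])^o.

Section Definitions.
Context {R : realType} {d : nat}.

Definition unit_vectors : set 'cV[R[i]]_d := [set v | v^t* *m v = 1%:M].

Definition herm : set 'M[R[i]]_d := [set X | X \is hermsymmx].

Definition herm1 : set 'M[R[i]]_d := [set X | herm X /\ \tr X = 1].

(* The order of R[i] entails that the quadratic form is real. *)
Definition density : set 'M[R[i]]_d :=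
  [set X | [/\ herm X,
               forall v : 'cV[R[i]]_d, 0 <= (v^t* *m X *m v) 0 0
             & \tr X = 1]].

(* The trace of a product of two Hermitian matrices is real; complex.Re
   only moves it from R[i] to R. *)
Definition hs_inner (A B : 'M[R[i]]_d) : R := complex.Re (\tr (A *m B)).

Definition pure_states (V : set 'cV[R[i]]_d) : set 'M[R[i]]_d :=
  [set v *m v^t* | v in V].

Definition polar (A : set 'M[R[i]]_d) : set 'M[R[i]]_d :=
  [set X | herm X /\ forall B, A B -> hs_inner X B <= 1].

Definition dual_cone (A : set 'M[R[i]]_d) : set 'M[R[i]]_d :=
  [set X | herm X /\ forall B, A B -> 0 <= hs_inner X B].

(* The coefficients are real: the ambient vector space is the real one of
   Hermitian matrices. *)
Definition convex_hull (A : set 'M[R[i]]_d) : set 'M[R[i]]_d :=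
  [set X | exists (n : nat) (c : 'I_n -> R) (P : 'I_n -> 'M[R[i]]_d),
     [/\ forall k, 0 <= c k, \sum_k c k = 1, forall k, A (P k)
       & X = \sum_k (c k)%:C *: P k]].

Definition atomic_gauge (A : set 'M[R[i]]_d) (X : 'M[R[i]]_d) : \bar R :=
  ereal_inf [set l%:E | l in
    [set l : R | 0 <= l /\ [set l%:C *: Y | Y in convex_hull A] X]].

Definition witness_measure (S C : set 'M[R[i]]_d) (rho : 'M[R[i]]_d) : \bar R :=
  ereal_sup [set (- hs_inner rho W)%:E | W in dual_cone S `&` C].

End Definitions.

(* Main.v *)
(* Weak and strong duality of the gauge: for a nonempty compact set A of Hermitian
   matrices, the gauge of A at p is the supremum of <Z, p> over Z in the polar of A.
   For the strong part, Caratheodory's theorem makes the set of conic combinations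
   of A of total weight at most mu compact; if p lies outside it, the difference
   between p and its nearest point in that set, suitably rescaled, is an element Z
   of the polar with <Z, p> > mu. The substitution W = s (1 - Z) then exchanges the
   polar of the union of the pure states and the rescaled X with the witnesses in
   the polar of X, because both families have constant trace: s = 1/2 when X has
   trace 1, s = 1 when X has trace -1. *)

Require Import Defs.
From HB Require Import structures.
From mathcomp Require Import all_boot all_order all_algebra.
From mathcomp Require Import sesquilinear spectral.
From mathcomp Require Import all_classical all_reals all_analysis.
From mathcomp Require Import complex.
From mathcomp Require Import ring lra.

Import Order.TTheory GRing.Theory Num.Theory.
Import numFieldNormedType.Exports.

Local Open Scope classical_set_scope.
Local Open Scope ring_scope.
Local Open Scope complex_scope.

(** * Hermitian matrices as a real Euclidean space *)

Section HermitianMatrices.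
Local Open Scope sesquilinear_scope.
Context {R : realType} {d : nat}.
Implicit Types (X Y : 'M[R[i]]_d) (a : R).

Lemma hermP X : herm X <-> X^t* = X.
Proof.
by split=> [/is_hermitianmxP|hX]; last (apply/is_hermitianmxP);
   rewrite expr0 scale1r.
Qed.

Lemma herm0 : herm (0 : 'M[R[i]]_d).
Proof. by apply/hermP; rewrite trmx0 map_mx0. Qed.

Lemma herm1M : herm (1%:M : 'M[R[i]]_d).
Proof. by apply/hermP; rewrite trmx1 map_mx1. Qed.

Lemma hermD X Y : herm X -> herm Y -> herm (X + Y).
Proof.
by move=> /hermP hX /hermP hY; apply/hermP; rewrite linearD map_mxD /= hX hY.
Qed.

Lemma hermZ a X : herm X -> herm (a%:C *: X).
Proof.
move=> /hermP hX; apply/hermP; rewrite linearZ/= map_mxZ /= hX.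
by congr (_ *: _); exact: conjc_real.
Qed.

Lemma hermN X : herm X -> herm (- X).
Proof. by move=> hX; rewrite -scaleN1r -(rmorphN1 (real_complex R)); exact: hermZ. Qed.

Lemma hermB X Y : herm X -> herm Y -> herm (X - Y).
Proof. by move=> hX hY; apply: hermD => //; exact: hermN. Qed.

Lemma herm_sum n (P : 'I_n -> 'M[R[i]]_d) :
  (forall k, herm (P k)) -> herm (\sum_k P k).
Proof. by move=> hP; apply: big_ind => //; [exact: herm0|exact: hermD]. Qed.

Lemma hs_innerC X Y : hs_inner X Y = hs_inner Y X.
Proof. by rewrite /hs_inner mxtrace_mulC. Qed.

Lemma hs_inner0r X : hs_inner X 0 = 0.
Proof. by rewrite /hs_inner mulmx0 linear0. Qed.

Lemma hs_innerDr X Y Z : hs_inner X (Y + Z) = hs_inner X Y + hs_inner X Z.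
Proof. by rewrite /hs_inner mulmxDr linearD raddfD. Qed.

Lemma hs_innerNr X Y : hs_inner X (- Y) = - hs_inner X Y.
Proof. by rewrite /hs_inner mulmxN linearN raddfN. Qed.

Lemma hs_innerBr X Y Z : hs_inner X (Y - Z) = hs_inner X Y - hs_inner X Z.
Proof. by rewrite hs_innerDr hs_innerNr. Qed.

Lemma hs_innerZr a X Y : hs_inner X (a%:C *: Y) = a * hs_inner X Y.
Proof.
rewrite /hs_inner -scalemxAr linearZ /=.
by case: (\tr _) => u v /=; rewrite mul0r subr0.
Qed.

Lemma hs_inner0l X : hs_inner 0 X = 0.
Proof. by rewrite hs_innerC hs_inner0r. Qed.

Lemma hs_innerBl X Y Z : hs_inner (X - Y) Z = hs_inner X Z - hs_inner Y Z.
Proof. by rewrite !(hs_innerC _ Z) hs_innerBr. Qed.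

Lemma hs_innerZl a X Y : hs_inner (a%:C *: X) Y = a * hs_inner X Y.
Proof. by rewrite !(hs_innerC _ Y) hs_innerZr. Qed.

Lemma hs_inner_sumr X n (c : 'I_n -> R) (P : 'I_n -> 'M[R[i]]_d) :
  hs_inner X (\sum_k (c k)%:C *: P k) = \sum_k c k * hs_inner X (P k).
Proof.
elim/big_rec2: _ => [|k y1 y2 _ <-]; first by rewrite hs_inner0r.
by rewrite hs_innerDr hs_innerZr.
Qed.

Lemma hs_inner1l X : hs_inner 1%:M X = complex.Re (\tr X).
Proof. by rewrite /hs_inner mul1mx. Qed.

(** Replacing [X] by [X^t*] turns the trace into a sum of conjugates of [X j i] times [Y j i], so
    the form is the dot product in real coordinates; positive definiteness follows. *)
Lemma hs_inner_herm X Y : herm X ->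
  hs_inner X Y = \sum_i \sum_j (complex.Re (X i j) * complex.Re (Y i j)
                               + complex.Im (X i j) * complex.Im (Y i j)).
Proof.
move=> /hermP hX; rewrite /hs_inner -{1}hX /mxtrace raddf_sum.
rewrite [RHS]exchange_big /=; apply: eq_bigr => i _.
rewrite mxE raddf_sum; apply: eq_bigr => j _; rewrite !mxE.
by case: (X j i) => a b; case: (Y j i) => u v /=; rewrite mulNr opprK.
Qed.

Lemma hs_inner_gt0 X : herm X -> X != 0 -> 0 < hs_inner X X.
Proof.
move=> hX X0; rewrite hs_inner_herm//.
have ge0 i j : 0 <= complex.Re (X i j) * complex.Re (X i j)
                    + complex.Im (X i j) * complex.Im (X i j).
  by rewrite addr_ge0// -expr2 sqr_ge0.
rewrite lt0r; apply/andP; split; last by do 2!apply: sumr_ge0 => ? _.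
apply: contra X0 => /eqP sum0; apply/eqP/matrixP => i j; rewrite mxE.
have /psumr_eq0P/(_ i isT)/psumr_eq0P/(_ j isT) := sum0.
move=> /(_ (fun k _ => ge0 _ _)) /(_ (fun k _ => sumr_ge0 _ (fun l _ => ge0 k l))).
move/eqP; rewrite paddr_eq0 -?expr2 ?sqr_ge0// !sqrf_eq0.
by case: (X i j) => u v /= /andP[/eqP-> /eqP->].
Qed.

End HermitianMatrices.

(** * Conic combinations of bounded weight and Caratheodory's theorem *)

Section ConicCombinations.
Context {R : realType} {d : nat}.
Implicit Types (A : set 'M[R[i]]_d) (X Y : 'M[R[i]]_d) (s t : R).

(** Fixing the number of terms makes this a continuous image of a compact set when [A] is compact;
    bounding the weight, rather than prescribing it, lets 0 belong to it. *)
Definition conic_comb A n s : set 'M[R[i]]_d :=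
  [set X | exists (c : 'I_n -> R) (P : 'I_n -> 'M[R[i]]_d),
     [/\ forall k, 0 <= c k, \sum_k c k <= s, forall k, A (P k)
       & X = \sum_k (c k)%:C *: P k]].

Lemma scale_real_sum t n (c : 'I_n -> R) (P : 'I_n -> 'M[R[i]]_d) :
  t%:C *: \sum_k (c k)%:C *: P k = \sum_k (t * c k)%:C *: P k.
Proof.
by under [RHS]eq_bigr do rewrite rmorphM -scalerA; exact: scaler_sumr.
Qed.

Lemma conic_comb_scale A n s t X : 0 <= t ->
  conic_comb A n s X -> conic_comb A n (t * s) (t%:C *: X).
Proof.
move=> t0 [c [P [c0 cs PA ->]]]; exists (fun k => t * c k), P; split => //.
- by move=> k; rewrite mulr_ge0.
- by rewrite -mulr_sumr ler_wpM2l.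
- exact: scale_real_sum.
Qed.

Lemma conic_comb_add A m n s t X Y :
  conic_comb A m s X -> conic_comb A n t Y ->
  conic_comb A (m + n) (s + t) (X + Y).
Proof.
move=> [c [P [c0 cs PA ->]]] [e [Q [e0 et QA ->]]].
pose glue T (f : 'I_m -> T) (g : 'I_n -> T) k :=
  match fintype.split k with inl i => f i | inr j => g j end.
have glueE T f g : (forall i, @glue T f g (lshift n i) = f i) /\
                   (forall j, @glue T f g (rshift m j) = g j).
  by split=> i; rewrite /glue ?(unsplitK (inl _))// ?(unsplitK (inr _)).
exists (glue _ c e), (glue _ P Q); split.
- by move=> k; rewrite /glue; case: fintype.split.
- rewrite big_split_ord /=; apply: lerD.
    by under eq_bigr do rewrite (glueE _ _ _).1.
  by under eq_bigr do rewrite (glueE _ _ _).2.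
- by move=> k; rewrite /glue; case: fintype.split.
- rewrite big_split_ord /=; congr (_ + _); apply: eq_bigr => k _.
    by rewrite !(glueE _ _ _).1.
  by rewrite !(glueE _ _ _).2.
Qed.

(** Complex matrices of size [d] have real dimension [d * d + d * d], whence a real dependence. Up
    to sign its sum is nonnegative, and a nonzero family with such a sum has a positive entry. *)
Lemma linear_dependence n (P : 'I_n -> 'M[R[i]]_d) : (d * d + d * d < n)%N ->
  exists u : 'I_n -> R, [/\ 0 <= \sum_k u k, exists k, 0 < u k
    & \sum_k (u k)%:C *: P k = 0].
Proof.
move=> ltn; suff [u [[l ul0] uP]] : exists u : 'I_n -> R,
    (exists k, u k != 0) /\ \sum_k (u k)%:C *: P k = 0.
  wlog u0 : u ul0 uP / 0 <= \sum_k u k => [hwlog|].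
    have [|/ltW su0] := leP 0 (\sum_k u k); first exact: hwlog uP.
    apply: (hwlog (fun k => -1 * u k)); first by rewrite mulN1r oppr_eq0.
      by rewrite -scale_real_sum uP scaler0.
    by rewrite -mulr_sumr mulN1r oppr_ge0.
  exists u; split=> //; apply: contrapT => /forallNP npos.
  have un k : u k <= 0 by rewrite leNgt; exact/negP/npos.
  have : \sum_k - u k = 0.
    by apply/eqP; rewrite sumrN oppr_eq0 eq_le u0 sumr_le0.
  move/psumr_eq0P => /(_ (fun k _ => etrans (oppr_ge0 _) (un k)) l isT)/eqP.
  by rewrite oppr_eq0 (negbTE ul0).
(* Real and imaginary parts are listed side by side, so that a left kernel vector is a dependence
   with real coefficients. *)
pose M : 'M[R]_(n, d * d + d * d) := \matrix_k
  row_mx (mxvec (map_mx (@complex.Re R) (P k))) (mxvec (map_mx (@complex.Im R) (P k))).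
have : kermx M != 0.
  by rewrite kermx_eq0 /row_free neq_ltn (leq_ltn_trans (rank_leq_col M)).
move=> /rowV0Pn[v /sub_kermxP vM /rV0Pn[l vl0]].
exists (v ord0); split; first by exists l.
move: vM; rewrite mulmx_sum_row.
under eq_bigr do rewrite rowK.
move=> vM; apply/matrixP => i j; rewrite summxE mxE.
have vMo o := congr1 (fun w : 'rV_(_ + _) => w ord0 o) vM.
have vRe : \sum_k v ord0 k * complex.Re (P k i j) = 0.
  have := vMo (lshift _ (mxvec_index i j)); rewrite summxE [RHS]mxE => {2}<-.
  by apply: eq_bigr => k _; rewrite mxE row_mxEl mxvecE mxE.
have vIm : \sum_k v ord0 k * complex.Im (P k i j) = 0.
  have := vMo (rshift _ (mxvec_index i j)); rewrite summxE [RHS]mxE => {2}<-.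
  by apply: eq_bigr => k _; rewrite mxE row_mxEr mxvecE mxE.
apply/eqP; rewrite eq_complex !raddf_sum /= -[X in _ == X]vRe -[X in _ && (_ == X)]vIm.
apply/andP; split; apply/eqP/eq_bigr => k _; rewrite mxE;
  by case: (P k i j) => a b /=; rewrite ?(mul0r, subr0, addr0).
Qed.

(* Move along a linear dependence until a first coefficient vanishes; orienting the
   dependence so that its coefficients have a nonnegative sum keeps the total
   weight from growing. *)
Lemma conic_combS A n s X : (d * d + d * d <= n)%N ->
  conic_comb A n.+1 s X -> conic_comb A n s X.
Proof.
move=> len [c [P [c0 cs PA ->]]].
have [u [su [l ul] uP]] := linear_dependence _ P len.
(* The smallest ratio is the longest step [t] that keeps every [c k - t * u k] nonnegative. *)
case: (@arg_minP _ _ _ l (fun k => 0 < u k) (fun k => c k / u k) ul) => m um mmin.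
pose t := c m / u m.
have t0 : 0 <= t by rewrite divr_ge0// ltW.
pose e k := c k - t * u k.
have e0 k : 0 <= e k.
  rewrite subr_ge0; have [uk|uk] := ltP 0 (u k).
    by rewrite -ler_pdivlMr//; exact: mmin.
  by rewrite (le_trans _ (c0 k))// mulr_ge0_le0.
have em : e m = 0 by rewrite /e /t mulfVK ?subrr// gt_eqF.
have eP : \sum_k (e k)%:C *: P k = \sum_k (c k)%:C *: P k.
  under eq_bigr do rewrite rmorphB scalerBl.
  by rewrite sumrB -scale_real_sum uP scaler0 subr0.
exists (fun k => e (lift m k)), (fun k => P (lift m k)); split=> //.
  apply: le_trans cs; rewrite (_ : \sum_k e _ = \sum_k e k).
    by rewrite sumrB -mulr_sumr gerBl mulr_ge0.
  by rewrite [RHS](bigD1_ord m)//= em add0r.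
by rewrite -eP (bigD1_ord m)//= em scale0r add0r.
Qed.

Lemma conic_comb0 A n s : A !=set0 -> 0 <= s -> conic_comb A n s 0.
Proof.
move=> [a Aa] s0; exists (fun=> 0), (fun=> a); split=> //; first by rewrite big1.
by rewrite big1// => k _; rewrite scale0r.
Qed.

(** Surplus terms are removed one at a time and missing ones padded with weight zero. With a common
    number of terms, one and the same set is both compact and convex. *)
Lemma caratheodory A n s X : 0 <= s -> A !=set0 ->
  conic_comb A n s X -> conic_comb A (d * d + d * d) s X.
Proof.
move=> s0 [a Aa]; have [len|/ltnW len] := leqP (d * d + d * d) n.
  rewrite -(subnK len); elim: (n - _)%N => // k IH.
  by rewrite addSn => /conic_combS-/(_ (leq_addl _ _))/IH.
move=> hX; rewrite -(subnKC len) -[s]addr0 -[X]addr0.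
by apply: conic_comb_add hX _; apply: conic_comb0 => //; exists a.
Qed.

End ConicCombinations.

(** * Continuity into and out of matrix spaces *)

Section MatrixContinuity.
Context {T : topologicalType}.

(** Entries lie in an arbitrary topological space because rows whose entries are matrices occur in
    [compact_conic_comb]. *)
Lemma coordT_continuous {U : topologicalType} m n i j :
  continuous (fun M : 'M[U]_(m, n) => M i j).
Proof.
move=> M B MB; exists (fun k l => [set y | (k, l) = (i, j) -> B y]).
  move=> k l; have [[-> ->]|kl] := pselect ((k, l) = (i, j)).
    by apply: filterS MB => y By _.
  by apply: filterS filterT => y _ /kl.
by move=> N /(_ i j); exact.
Qed.

Lemma continuous_mx {U : topologicalType} m n (f : T -> 'M[U]_(m, n)) :
  (forall i j, continuous (fun x => f x i j)) -> continuous f.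
Proof.
move=> fc x B [P fxP PB].
have : \forall y \near x, forall ij : 'I_m * 'I_n, P ij.1 ij.2 (f y ij.1 ij.2).
  by apply: filter_forall => -[i j]; exact: fc (fxP i j).
by apply: filterS => y Py; apply: PB => i j; exact: Py (i, j).
Qed.

Lemma continuous_compT {U W : topologicalType} (g : U -> W) (f : T -> U) :
  continuous g -> continuous f -> continuous (fun x => g (f x)).
Proof. by move=> gc fc x; exact: (continuous_comp (fc x) (gc _)). Qed.

Lemma continuous_mul {K : numFieldType} (f g : T -> K) :
  continuous f -> continuous g -> continuous (fun x => f x * g x).
Proof. by move=> fc gc x; exact: (cvgM (fc x) (gc x)). Qed.

Lemma continuous_sub {K : numFieldType} (f g : T -> K) :
  continuous f -> continuous g -> continuous (fun x => f x - g x).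
Proof. by move=> fc gc x; exact: (cvgB (fc x) (gc x)). Qed.

Lemma continuous_sum {K : numFieldType} {V : normedModType K} n (f : 'I_n -> T -> V) :
  (forall k, continuous (f k)) -> continuous (fun x => \sum_k f k x).
Proof. by move=> fc; apply: continuous_big => //; exact: add_continuous. Qed.

End MatrixContinuity.

(** * Topology of complex matrices and compactness of conic combinations *)

Section ComplexContinuity.
Local Open Scope sesquilinear_scope.
Context {R : realType}.

Lemma Re_continuous : continuous (@complex.Re R : R[i] -> R).
Proof.
move=> x B /nbhs_ballP[e e0 eB]; apply/nbhs_ballP; exists e%:C; first by rewrite /= ltcR.
move=> y; rewrite -ball_normE /= => xy; apply: eB; rewrite -ball_normE /=.
by rewrite -ltcR -raddfB (le_lt_trans (normc_ge_Re _)).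
Qed.

Lemma real_complex_continuous : continuous (real_complex R : R -> R[i]).
Proof.
(* Radii of balls in [R[i]] are complex numbers; positivity forces the imaginary part to vanish. *)
move=> x B /nbhs_ballP[[a b]]; rewrite /= ltcE /= => /andP[/eqP-> a0] eB.
apply/nbhs_ballP; exists a => // y; rewrite -ball_normE /= => xy.
apply: eB; rewrite -ball_normE /= -rmorphB normc_def /= expr0n addr0 sqrtr_sqr.
by rewrite ltcR.
Qed.

Lemma conj_continuous : continuous (@conjc R : R[i] -> R[i]).
Proof.
move=> x B /nbhs_ballP[e e0 eB]; apply/nbhs_ballP; exists e => // y.
rewrite -ball_normE /= => xy; apply: eB; rewrite -ball_normE /=.
by rewrite -rmorphB normcJ.
Qed.

Lemma continuous_pure_state d :
  continuous (fun v : 'cV[R[i]]_d => v *m v^t* : 'M[R[i]]_d).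
Proof.
apply: continuous_mx => i j.
rewrite (_ : (fun _ => _) = fun v : 'cV[R[i]]_d => v i 0 * (v j 0)^*); last first.
  by apply: funext => v; rewrite mxE big_ord1 !mxE.
apply: continuous_mul; first exact: coordT_continuous.
by apply: (continuous_compT (@conjc R)); [exact: conj_continuous|exact: coordT_continuous].
Qed.

(** Between Hermitian matrices this is the squared distance to [p]; its minimiser over a compact set
    is a nearest point. *)
Lemma continuous_hs_inner_sub d (p : 'M[R[i]]_d) :
  continuous (fun X : 'M[R[i]]_d => hs_inner (p - X) (p - X)).
Proof.
rewrite (_ : (fun _ => _) = @complex.Re R \o
  (fun X : 'M[R[i]]_d => \sum_i \sum_j (p i j - X i j) * (p j i - X j i))); last first.
  apply: funext => X; rewrite /hs_inner /mxtrace /=; congr complex.Re.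
  by apply: eq_bigr => i _; rewrite mxE; apply: eq_bigr => j _; rewrite !mxE.
apply: (continuous_compT (@complex.Re R)); first exact: Re_continuous.
have sub_cont i j : continuous (fun X : 'M[R[i]]_d => p i j - X i j).
  by apply: continuous_sub; [exact: cst_continuous|exact: coordT_continuous].
by apply: continuous_sum => i; apply: continuous_sum => j; exact: continuous_mul.
Qed.

Lemma compact_pure_states d (V : set 'cV[R[i]]_d) :
  compact V -> compact (pure_states V).
Proof.
by move=> Vc; apply: continuous_compact Vc; apply: continuous_subspaceT;
   exact: continuous_pure_state.
Qed.

Lemma compact_scale d (a : R[i]) (X : set 'M[R[i]]_d) :
  compact X -> compact [set a *: x | x in X].
Proof.
move=> Xc; apply: continuous_compact Xc; apply: continuous_subspaceT.
apply: continuous_mx => i j; rewrite (_ : (fun _ => _) = fun M : 'M[R[i]]_d => a * M i j).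
  apply: continuous_mul; last exact: coordT_continuous.
  exact: cst_continuous.
by apply: funext => M; rewrite mxE.
Qed.

(** The weights range over the box [[0, s]] to the power [n], cut by a closed condition on their
    sum, and the points over a power of [A]; the combination depends continuously on both. *)
Lemma compact_conic_comb d (A : set 'M[R[i]]_d) n s :
  compact A -> compact (conic_comb A n s).
Proof.
move=> Ac.
pose T : topologicalType := ('rV[R]_n * 'rV['M[R[i]]_d]_n)%type.
pose f (w : T) := \sum_k (w.1 ord0 k)%:C *: w.2 ord0 k.
pose W : set T := [set c : 'rV[R]_n | forall k, [set` `[0, s]] (c ord0 k)]
              `*` [set P : 'rV['M[R[i]]_d]_n | forall k, A (P ord0 k)].
pose g (w : T) := \sum_k w.1 ord0 k.
have fst_cont k : continuous (fun w : T => w.1 ord0 k).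
  apply: (@continuous_compT T _ _ (fun c : 'rV[R]_n => c ord0 k)).
    exact: coordT_continuous.
  by move=> w; exact: cvg_fst.
have snd_cont k i j : continuous (fun w : T => w.2 ord0 k i j).
  apply: (@continuous_compT T _ _ (fun M : 'M[R[i]]_d => M i j)).
    exact: coordT_continuous.
  apply: (@continuous_compT T _ _ (fun P : 'rV['M[R[i]]_d]_n => P ord0 k)).
    exact: coordT_continuous.
  by move=> w; exact: cvg_snd.
have -> : conic_comb A n s = f @` (W `&` g @^-1` [set t | t <= s]).
  apply/seteqP; split=> [X [c [P [c0 cs PA ->]]]|_ [w [[wc wP] ws] <-]].
    exists (\row_k c k, \row_k P k); last first.
      by apply: eq_bigr => k _; rewrite !mxE.
    split; last by rewrite /g /=; under eq_bigr do rewrite mxE.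
    split=> k /=; rewrite mxE // in_itv /= c0 /=.
    by apply: le_trans cs; rewrite (bigD1 k)//= lerDl sumr_ge0.
  exists (fun k => w.1 ord0 k), (fun k => w.2 ord0 k); split=> // k.
  by have := wc k; rewrite /= in_itv/= => /andP[].
apply: continuous_compact; last first.
  apply: compact_closedI.
    apply: compact_setX; last exact: (@rV_compact _ n (fun=> A)).
    by apply: (@rV_compact _ n (fun=> [set` `[0, s]])) => k; exact: segment_compact.
  apply: closed_comp; last exact: closed_le.
  by move=> w _; exact: continuous_sum.
apply: continuous_subspaceT; apply: continuous_mx => i j.
rewrite (_ : (fun _ => _) = fun w : T =>
    \sum_k (w.1 ord0 k)%:C * w.2 ord0 k i j); last first.
  by apply: funext => w; rewrite summxE; apply: eq_bigr => k _; rewrite mxE.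
apply: continuous_sum => k; apply: continuous_mul; last exact: snd_cont.
apply: (continuous_compT (real_complex R)) (fst_cont k).
exact: real_complex_continuous.
Qed.

End ComplexContinuity.

(** * Separation and duality for the atomic gauge *)

Section GaugeDuality.
Context {R : realType} {d : nat}.
Implicit Types (A : set 'M[R[i]]_d) (p x y : 'M[R[i]]_d) (mu : R).

Lemma conic_comb_herm A n mu x : A `<=` herm -> conic_comb A n mu x -> herm x.
Proof.
move=> Ah [c [P [_ _ PA ->]]]; apply: herm_sum => k.
by apply: hermZ; exact: Ah.
Qed.

Lemma hs_inner_sub_sqr x y (t : R) :
  hs_inner (x - t%:C *: y) (x - t%:C *: y)
    = hs_inner x x - 2 * t * hs_inner x y + t ^+ 2 * hs_inner y y.
Proof.
rewrite hs_innerBl !hs_innerBr !hs_innerZl !hs_innerZr (hs_innerC y x).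
by ring.
Qed.

(** First-order optimality of a nearest point: if [p - x] had a positive inner product with [y - x],
    some step from [x] towards [y] would come closer to [p]. *)
Lemma projection_obtuse p x y : herm p -> herm x -> herm y ->
  (forall t : R, 0 <= t <= 1 ->
     hs_inner (p - x) (p - x)
       <= hs_inner (p - (x + t%:C *: (y - x))) (p - (x + t%:C *: (y - x)))) ->
  hs_inner (p - x) y <= hs_inner (p - x) x.
Proof.
move=> hp hx hy closest; rewrite leNgt -subr_gt0 -hs_innerBr; apply/negP.
set w := y - x; set z := p - x => a0.
have b0 : 0 <= hs_inner w w.
  have [->|w0] := eqVneq w 0; first by rewrite hs_inner0r.
  by apply/ltW/hs_inner_gt0 => //; exact: hermB.
set a := hs_inner z w in a0; set b := hs_inner w w in b0.
(* The unconstrained minimiser [a / b] may exceed 1; adding [a] to the denominator keeps the step in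
   the unit interval and still decreases the distance. *)
pose t := a / (a + b).
have ab0 : 0 < a + b by rewrite ltr_wpDr.
have t01 : 0 <= t <= 1.
  by rewrite divr_ge0 ?(ltW a0) ?(ltW ab0)//= ler_pdivrMr// mul1r lerDl.
have t0 : 0 < t by rewrite divr_gt0.
have tab : t * (a + b) = a by rewrite divfK// gt_eqF.
have := closest t t01; rewrite opprD addrA -/z -/w.
rewrite hs_inner_sub_sqr -/a -/b.
(* Since [t * b = a - t * a], the squared distance changes by [- t * a * (1 + t)], which is
   negative. *)
nra.
Qed.

(** The bipolar theorem at level [mu]. Positivity of [mu] keeps the rescaled separating functional
    nonzero. *)
Lemma polar_separation A p mu : compact A -> A `<=` herm -> A !=set0 -> herm p ->
  0 < mu -> (forall Z, polar A Z -> hs_inner Z p <= mu) ->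
  conic_comb A (d * d + d * d) mu p.
Proof.
move=> Ac Ah A0 hp mu0 polar_le; apply: contrapT => pK.
set N := (d * d + d * d)%N in pK *.
have mu_ge0 := ltW mu0.
have K0 : conic_comb A N mu 0 by exact: conic_comb0.
have [x] := compact_EVT_min (ex_intro _ 0 K0) (compact_conic_comb _ A N mu Ac)
  (continuous_subspaceT (continuous_hs_inner_sub _ p)).
rewrite inE => Kx xmin.
have hx : herm x by exact: conic_comb_herm Kx.
have hz : herm (p - x) by exact: hermB.
have z0 : p - x != 0.
  by apply/eqP => /eqP; rewrite subr_eq0 => /eqP px; apply: pK; rewrite px.
have obtuse y : conic_comb A N mu y -> hs_inner (p - x) y <= hs_inner (p - x) x.
  move=> Ky; apply: projection_obtuse => //; first exact: conic_comb_herm Ky.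
  move=> t /andP[t0 t1]; apply: xmin; rewrite inE.
  have -> : x + t%:C *: (y - x) = (1 - t)%:C *: x + t%:C *: y.
    by rewrite rmorphB scalerBl scale1r scalerBr addrA addrAC.
  (* Convexity: a mixture of two combinations has [N + N] terms, which are reduced to [N] again. *)
  apply: (caratheodory A (N + N)) => //.
  have -> : mu = (1 - t) * mu + t * mu by ring.
  by apply: conic_comb_add; apply: conic_comb_scale => //; rewrite subr_ge0.
set m := hs_inner (p - x) x in obtuse.
have m0 : 0 <= m by rewrite -(hs_inner0r (p - x)); exact: obtuse.
have mp : m < hs_inner (p - x) p.
  by rewrite -subr_gt0 -hs_innerBr; exact: hs_inner_gt0.
(* Any level strictly between [m] and [hs_inner (p - x) p] normalises the
   separating functional; the midpoint is positive even when [m = 0]. *)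
pose s := (m + hs_inner (p - x) p) / 2.
have ms : m < s by rewrite /s; lra.
have sp : s < hs_inner (p - x) p by rewrite /s; lra.
have s0 : 0 < s by exact: le_lt_trans ms.
(* The factor [mu / s] lands in the polar: each [mu] times [a] is a one-term combination, so its
   product with [p - x] is at most [m < s]. *)
have : hs_inner ((mu / s)%:C *: (p - x)) p <= mu.
  apply: polar_le; split=> [|a Aa]; first exact: hermZ.
  rewrite hs_innerZl mulrAC ler_pdivrMr// mul1r.
  apply: le_trans (ltW ms); rewrite -hs_innerZr; apply: obtuse.
  apply: (caratheodory A 1) => //; exists (fun=> mu), (fun=> a).
  by split=> //; rewrite big_ord1.
rewrite hs_innerZl mulrAC ler_pdivrMr// ler_pM2l// => /(lt_le_trans sp).
by rewrite ltxx.
Qed.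

Lemma atomic_gauge_le A n mu p : A !=set0 ->
  conic_comb A n mu p -> (atomic_gauge A p <= mu%:E)%E.
Proof.
move=> [a Aa] [c [P [c0 cmu PA ->]]].
have s0 : 0 <= \sum_k c k by rewrite sumr_ge0.
apply: (@le_trans _ _ (\sum_k c k)%:E); last by rewrite lee_fin.
apply: ereal_inf_lbound; exists (\sum_k c k) => //; split=> //=.
(* A zero total weight cannot be divided out; the matrix is then 0, which is 0 times any point of
   the hull. *)
have [sum0|sum_neq0] := eqVneq (\sum_k c k) 0.
  have cE k : c k = 0 by have /psumr_eq0P := sum0; apply.
  exists a; last first.
    by rewrite sum0 scale0r big1// => k _; rewrite cE scale0r.
  by exists 1, (fun=> 1), (fun=> a); split=> //; rewrite ?big_ord1 ?scale1r.
exists ((\sum_k c k)^-1%:C *: \sum_k (c k)%:C *: P k); last first.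
  by rewrite scalerA -rmorphM divff// scale1r.
exists n, (fun k => (\sum_k c k)^-1 * c k), P; split=> //.
- by move=> k; rewrite mulr_ge0 ?invr_ge0.
- by rewrite -mulr_sumr mulVf.
- exact: scale_real_sum.
Qed.

(** Weak duality: the bound 1 on [A] passes to the convex hull and scales with [l]. *)
Lemma atomic_gauge_ge A Z p : polar A Z -> ((hs_inner Z p)%:E <= atomic_gauge A p)%E.
Proof.
move=> [hZ ZA]; apply: le_ereal_inf_tmp => _ [l [l0 [_ [n [c [P [c0 c1 PA ->]]]] <-]] <-].
rewrite lee_fin hs_innerZr hs_inner_sumr -[leRHS]mulr1 ler_wpM2l//.
rewrite -c1; apply: ler_sum => k _; rewrite -[leRHS]mulr1 ler_wpM2l//.
exact: ZA.
Qed.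

(** Strong duality. Separation needs a positive level, so it is applied at [mu + e] for every
    [e > 0], which also covers [mu = 0]. *)
Lemma atomic_gauge_dual A p mu : compact A -> A `<=` herm -> A !=set0 -> herm p ->
  0 <= mu -> (forall Z, polar A Z -> hs_inner Z p <= mu) ->
  (atomic_gauge A p <= mu%:E)%E.
Proof.
move=> Ac Ah A0 hp mu0 polar_le; apply/lee_addgt0Pr => e e0.
rewrite -EFinD; apply: (atomic_gauge_le _ _ _ _ A0); apply: polar_separation => //.
  by rewrite ltr_wpDl.
by move=> Z /polar_le/le_trans; apply; rewrite lerDl ltW.
Qed.

(* The substitution [W = s (1 - Z)] turns the dual feasible set of the gauge into
   the set of witnesses. *)
Lemma witness_sup_gauge A (D : set 'M[R[i]]_d) p s : compact A -> A `<=` herm ->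
  A !=set0 -> herm p -> \tr p = 1 -> 0 < s ->
  (forall Z, herm Z -> polar A Z <-> D (s%:C *: (1%:M - Z))) -> D `<=` herm ->
  ereal_sup [set (- hs_inner p W)%:E | W in D] = (s%:E * (atomic_gauge A p - 1))%E.
Proof.
move=> Ac Ah A0 hp tp s0 polarD Dh.
have val Z : - hs_inner p (s%:C *: (1%:M - Z)) = s * (hs_inner Z p - 1).
  rewrite hs_innerZr hs_innerBr (hs_innerC p 1%:M) hs_inner1l tp /= (hs_innerC p).
  by ring.
have DE W : D W -> exists2 Z, polar A Z & W = s%:C *: (1%:M - Z).
  move=> DW; pose Z := 1%:M - s^-1%:C *: W.
  have WE : W = s%:C *: (1%:M - Z).
    by rewrite opprB addrC subrK scalerA -rmorphM divff ?scale1r// gt_eqF.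
  exists Z => //; apply/polarD; last by rewrite -WE.
  by apply: hermB; [exact: herm1M|apply: hermZ; exact: Dh].
(* The point 0 serves twice: it keeps the supremum away from minus infinity, and it makes the level
   [v / s + 1] used below nonnegative. *)
have polar0 : polar A 0 by split=> [|B _]; [exact: herm0|rewrite hs_inner0l].
set S := ereal_sup _.
have S_ge Z : polar A Z -> ((s * (hs_inner Z p - 1))%:E <= S)%E.
  move=> [hZ ZA]; apply: ereal_sup_ubound; exists (s%:C *: (1%:M - Z)); last by rewrite val.
  by apply/polarD.
apply/eqP; rewrite eq_le; apply/andP; split.
  apply: ge_ereal_sup => _ [W /DE[Z ZA ->] <-]; rewrite val EFinM.
  rewrite lee_pmul2l// EFinB leeD2r//; exact: atomic_gauge_ge.
case SE : S => [v| |]; last 2 first.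
- by rewrite leey.
- by have := S_ge _ polar0; rewrite SE leeNy_eq.
have le_v Z : polar A Z -> hs_inner Z p <= v / s + 1.
  by move=> /S_ge; rewrite SE lee_fin -lerBlDr ler_pdivlMr// mulrC.
have : (atomic_gauge A p <= (v / s + 1)%:E)%E.
  by apply: atomic_gauge_dual => //; rewrite -(hs_inner0l p); exact: le_v.
move=> /(leeD2r (- 1)%E); rewrite -EFinB addrK -(@lee_pmul2l _ s%:E)// -EFinM.
by rewrite mulrC divfK// gt_eqF.
Qed.

End GaugeDuality.

(** * Witnesses constrained by a polar set of constant trace *)

Section WitnessMeasure.
Local Open Scope sesquilinear_scope.
Context {R : realType} {d : nat}.
Implicit Types (V : set 'cV[R[i]]_d) (X : set 'M[R[i]]_d).

Lemma pure_states_herm1 V : V `<=` unit_vectors -> pure_states V `<=` herm1.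
Proof.
move=> Vu _ [v /Vu vv <-]; split.
  apply/hermP/matrixP => i j; rewrite !mxE !big_ord1 !mxE rmorphM /= mulrC.
  by congr (_ * _); exact: conjcK.
by rewrite mxtrace_mulC vv mxtrace1.
Qed.

(** Both cases at once. For [W = s (1 - Z)] and [x] of trace [tau], the bound [<W, x> <= 1] reads
    [- s <Z, x> <= 1 - s tau]; dividing by the positive right-hand side yields the factor in front
    of [x]. On pure states, [<W, B> >= 0] reads [<Z, B> <= 1]. *)
Lemma witness_measure_polar V X (rho : 'M[R[i]]_d) (s tau : R) :
  V !=set0 -> compact V -> V `<=` unit_vectors ->
  compact X -> X `<=` [set x | herm x /\ \tr x = tau%:C] -> density rho ->
  0 < s -> s * tau < 1 ->
  witness_measure (pure_states V) (polar X) rho =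
    (s%:E * (atomic_gauge (pure_states V
       `|` [set (- (s / (1 - s * tau)))%:C *: x | x in X]) rho - 1))%E.
Proof.
move=> [v0 Vv0] Vc Vu Xc Xtau [hrho _ trho] s0 stau; set a := - (s / _).
have Sh := pure_states_herm1 _ Vu.
apply: witness_sup_gauge => //.
- by apply: compactU; [exact: compact_pure_states|exact: compact_scale].
- move=> _ [/Sh[]//|[x /Xtau[hx _] <-]]; exact: hermZ.
- by exists (v0 *m v0^t*); left; exists v0.
- move=> Z hZ; have hW : herm (s%:C *: (1%:M - Z)).
    by apply: hermZ; apply: hermB => //; exact: herm1M.
  have valW B : hs_inner (s%:C *: (1%:M - Z)) B = s * (complex.Re (\tr B) - hs_inner Z B).
    by rewrite hs_innerZl hs_innerBl hs_inner1l.
  have st0 : 0 < 1 - s * tau by rewrite subr_gt0.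
  have scaled x : X x -> (hs_inner Z (a%:C *: x) <= 1)
                       = (hs_inner (s%:C *: (1%:M - Z)) x <= 1).
    move=> /Xtau[_ tx]; rewrite valW tx hs_innerZr /=.
    rewrite /a mulNr mulrAC -mulNr ler_pdivrMr// mul1r mulrBr.
    by rewrite lerBrDr addrC.
  split=> [[_ ZA]|[[_ WS] [_ WX]]]; split=> //.
  + split=> // B SB; rewrite valW; have [_ ->] := Sh _ SB.
    by rewrite mulr_ge0 ?(ltW s0)// subr_ge0; apply: ZA; left.
  + by split=> // x Xx; rewrite -scaled//; apply: ZA; right; exists x.
  + move=> B [SB|[x Xx <-]]; last by rewrite scaled//; exact: WX.
    have := WS _ SB; rewrite valW; have [_ ->] := Sh _ SB.
    by rewrite pmulr_rge0// subr_ge0.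
- by move=> W [_ []].
Qed.

End WitnessMeasure.

Theorem proposition22 (R : realType) (d : nat) (d_ge1 : (1 <= d)%N)
    (V : set 'cV[R[i]]_d) (V_neq0 : V !=set0) (V_compact : compact V)
    (V_unit : V `<=` unit_vectors)
    (V_phase : forall (v : 'cV[R[i]]_d) (theta : R),
       V v -> V ((cos theta +i* sin theta) *: v))
    (C : set 'M[R[i]]_d) (C_herm : C `<=` herm) :
  (forall X : set 'M[R[i]]_d, compact X -> X `<=` herm1 -> C = polar X ->
     forall rho : 'M[R[i]]_d, density rho ->
       witness_measure (pure_states V) C rho =
         ((2^-1)%:E *
           (atomic_gauge (pure_states V `|` [set (- x)%R | x in X]) rho - 1))%E)
  /\
  (forall Y : set 'M[R[i]]_d, compact Y -> Y `<=` [set - x | x in herm1] ->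
     C = polar Y ->
     forall rho : 'M[R[i]]_d, density rho ->
       witness_measure (pure_states V) C rho =
         (atomic_gauge
            (pure_states V `|` [set (- 2^-1 *: y)%R | y in Y]) rho - 1)%E).
Proof.
split=> [X Xc X1 -> rho rhoD|Y Yc Y1 -> rho rhoD].
- have half_lt1 : 2^-1 * 1 < 1 :> R by rewrite mulr1 invf_lt1// ltr1n.
  rewrite (witness_measure_polar V X rho 2^-1 1)//.
  (* For trace 1, the choice [s = 1/2] is the one that rescales [X] to exactly [- X]. *)
  have -> : - (2^-1 / (1 - 2^-1 * 1)) = -1 :> R by field.
  by under eq_imagel do rewrite rmorphN scaleN1r.
- have Y_tr : Y `<=` [set y | herm y /\ \tr y = (-1)%:C].
    by move=> _ /Y1[x [hx tx] <-]; split; [exact: hermN|rewrite linearN/= tx rmorphN].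
  have opp_lt1 : 1 * -1 < 1 :> R by rewrite mul1r (lt_trans _ ltr01)// ltrN10.
  rewrite (witness_measure_polar V Y rho 1 (-1))//.
  (* For trace -1, [s = 1] removes the outer factor and leaves [- 1/2] in front of [Y]. *)
  have -> : - (1 / (1 - 1 * -1)) = - 2^-1 :> R by field.
  by rewrite mul1e rmorphN fmorphV rmorph_nat.
Qed.
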